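(* Let $n\ge 3$ and let $\mathscr C=\{i_1,\dots,i_k,j_1,\dots,j_m\}$ be an admissible subchain of $\{1,\dots,n-1\}$. Then there is a bijective correspondence between the set of words $\mathbb X_{\mathscr C}$ and the set of perfect matchings of the snake graph $\mathcal G_{\mathscr C}$.
   Context: An admissible subchain $\mathscr C$ of $\{1,\dots,n-1\}$ is a subset containing $1$ and $n-1$ (its elements, in increasing order, being alternately named $i$'s and $j$'s). Alphabet. A Dyck path of length $2n$ is a word in $U,D$ with $n$ letters of each kind in which every prefix has at least as many $U$'s as $D$'s. For $1\le i\le n-2$ put $U_1^i=U^{i+1}D^{i+1}(UD)^{n-i-1}$, $U_2^i=(UD)^iU^{n-i}D^{n-i}$, and $E_n=U^nD^n$ (Dyck paths of length $2n$). The alphabet is $H_n=\{U_r^i: r=1,2,\ 1\le i\le n-2\}\cup\{E_n\}$. $\mathbb X_{\mathscr C}$ is the set of words $V=V_1V_2\cdots V_{n-2}$ with $V_i\in\{E_n,U_1^i,U_2^i\}$, $V_1$ arbitrary, such that for $1<i\le n-2$: if $i\in\mathscr C$, then $V_i\in\{E_n,U_2^{i}\}$ when $V_{i-1}\in\{E_n,U_1^{i-1}\}$, and $V_i=U_1^{i}$ when $V_{i-1}=U_2^{i-1}$; if $i\notin\mathscr C$, then $V_i=U_1^{i}$ when $V_{i-1}\in\{E_n,U_1^{i-1}\}$, and $V_i\in\{E_n,U_2^{i}\}$ when $V_{i-1}=U_2^{i-1}$. Snake graphs. A tile is a unit square, viewed as a graph with four vertices and four edges. A snake graph $(G_1,\dots,G_d)$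 is a sequence of tiles in the plane in which $G_{i+1}$ is glued to $G_i$ either with its south edge along the north edge of $G_i$, or with its west edge along the east edge of $G_i$. $\mathcal G_{\mathscr C}=(G_1,\dots,G_{n-1})$ is the snake graph (unique up to reflection) such that for $1<i<n-1$ the tiles $G_{i-1},G_i,G_{i+1}$ lie in a straight row or column if and only if $i\in\mathscr C$. A perfect matching of a graph is a set of edges such that each vertex is incident to exactly one of them. *)

(* Defs.v *)
From mathcomp Require Import all_boot all_order all_algebra.
From mathcomp Require Import finmap.
From mathcomp Require Import zify.

Set Implicit Arguments.
Unset Strict Implicit.
Unset Printing Implicit Defensive.

Local Open Scope fset_scope.
Local Open Scope nat_scope.

(* The alternate naming i_1 < j_1 < i_2 < ... of the elements of C carries no
   information beyond C itself. *)
Definition admissible (n : nat) (C : {fset nat}) : bool :=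
  [&& all (fun i => 1 <= i <= n - 1) C, 1 \in C & n - 1 \in C].

Definition step := bool.
Definition U : step := true.
Definition D : step := false.

Definition is_dyck (n : nat) (w : seq step) : bool :=
  [&& count_mem U w == n, count_mem D w == n &
      all (fun l => count_mem D (take l w) <= count_mem U (take l w))
          (iota 0 (size w).+1)].

Definition UD_pow (k : nat) : seq step := flatten (nseq k [:: U; D]).
Definition E_ (n : nat) : seq step := nseq n U ++ nseq n D.
Definition U1 (n i : nat) : seq step := E_ i.+1 ++ UD_pow (n - i - 1).
Definition U2 (n i : nat) : seq step := UD_pow i ++ E_ (n - i).

(* V_i, numbered from 1. *)
Definition letter (V : seq (seq step)) (i : nat) : seq step := nth [::] V i.-1.

(* [index_iota a b] enumerates the i with a <= i < b. *)
Definition in_X (n : nat) (C : {fset nat}) (V : seq (seq step)) : bool :=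
  let L := letter V in
  [&& size V == n - 2,
      all (fun i => L i \in [:: E_ n; U1 n i; U2 n i]) (index_iota 1 (n - 1)) &
      all (fun i =>
             if i \in C then
               ((L i.-1 \in [:: E_ n; U1 n i.-1]) ==>
                  (L i \in [:: E_ n; U2 n i])) &&
               ((L i.-1 == U2 n i.-1) ==> (L i == U1 n i))
             else
               ((L i.-1 \in [:: E_ n; U1 n i.-1]) ==> (L i == U1 n i)) &&
               ((L i.-1 == U2 n i.-1) ==> (L i \in [:: E_ n; U2 n i])))
          (index_iota 2 (n - 1))].

Definition X (n : nat) (C : {fset nat}) : Type :=
  {V : seq (seq step) | in_X n C V}.

(* A finite simple graph is given by its vertex set V and its edge set E, each
   edge being the set of its two endpoints. *)
Definition is_perfect_matching (K : choiceType) (V : {fset K})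
    (E M : {fset {fset K}}) : bool :=
  (M `<=` E) && all (fun v => #|` [fset e in M | v \in e]| == 1) V.

Definition perfect_matchings (K : choiceType) (V : {fset K})
    (E : {fset {fset K}}) : Type :=
  {M : {fset {fset K}} | is_perfect_matching V E M}.

Definition point := (int * int)%type.
Definition north (p : point) : point := (p.1, p.2 + 1)%R.
Definition east (p : point) : point := (p.1 + 1, p.2)%R.

(* The unit tile [p, p + (1, 1)] is represented by its south-west corner p. *)
Definition tile := point.
Definition south_edge (p : tile) : {fset point} := [fset p; east p].
Definition north_edge (p : tile) : {fset point} :=
  [fset north p; north (east p)].
Definition west_edge (p : tile) : {fset point} := [fset p; north p].
Definition east_edge (p : tile) : {fset point} := [fset east p; north (east p)].

Definition tile_vertices (p : tile) : {fset point} :=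
  [fset p; east p; north p; north (east p)].
Definition tile_edges (p : tile) : {fset {fset point}} :=
  [fset south_edge p; north_edge p; west_edge p; east_edge p].

Definition glued (p q : tile) : bool :=
  (south_edge q == north_edge p) || (west_edge q == east_edge p).

(* Tiles of a snake only move north or east, so the union of the tiles in the
   plane makes no identification beyond those forced by the gluings. *)
Definition is_snake (T : seq tile) : bool := sorted glued T.
Definition snake_vertices (T : seq tile) : {fset point} :=
  \bigcup_(p <- T) tile_vertices p.
Definition snake_edges (T : seq tile) : {fset {fset point}} :=
  \bigcup_(p <- T) tile_edges p.

(* Tile G_i, numbered from 1. *)
Definition nth_tile (T : seq tile) (i : nat) : tile := nth (0, 0)%R T i.-1.

Definition straight (p q r : tile) : bool :=
  ((p.1 == q.1) && (q.1 == r.1)) || ((p.2 == q.2) && (q.2 == r.2)).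

(* T realizes G_C; such a T is unique up to translation and reflection. *)
Definition is_snake_of (n : nat) (C : {fset nat}) (T : seq tile) : bool :=
  [&& size T == n - 1, is_snake T &
      all (fun i => straight (nth_tile T i.-1) (nth_tile T i) (nth_tile T i.+1)
                      == (i \in C))
          (index_iota 2 (n - 1))].

Lemma gluedE (p q : tile) : glued p q = (q == north p) || (q == east p).
Proof.
have P2 (a b c d : point) : [fset a; b] = [fset c; d] ->
    (a = c \/ a = d) /\ (b = c \/ b = d) /\ (c = a \/ c = b).
  move=> /fsetP e; move: (e a) (e b) (e c).
  rewrite !inE !eqxx /= ?orbT => /esym/orP h1 /esym/orP h2 /orP h3.
  by repeat split; [case: h1|case: h2|case: h3] => /eqP ->; auto.
case: p q => [a b] [c d]; apply/orP/orP => -[] /eqP.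
- rewrite /south_edge /north_edge => /P2; rewrite /north /east /=.
  move=> [h1 [h2 h3]]; left; apply/eqP.
  by case: h1 => -[e1 e2]; case: h2 => -[e3 e4]; congr pair; lia.
- rewrite /west_edge /east_edge => /P2; rewrite /north /east /=.
  move=> [h1 [h2 h3]]; right; apply/eqP.
  by case: h1 => -[e1 e2]; case: h2 => -[e3 e4]; congr pair; lia.
- by move=> ->; left.
- by move=> ->; right.
Qed.

(* The direction (true for east) of the gluing of G_{i+2} to G_{i+1}. *)
Fixpoint turn (C : {fset nat}) (i : nat) : bool :=
  if i is k.+1 then (if i.+1 \in C then turn C k else ~~ turn C k) else true.
Fixpoint canonical_tile (C : {fset nat}) (i : nat) : tile :=
  if i is k.+1 then
    (if turn C k then east else north) (canonical_tile C k)
  else (0, 0)%R.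

Lemma is_snake_of_exists (n : nat) (C : {fset nat}) :
  exists T, is_snake_of n C T.
Proof.
exists (mkseq (canonical_tile C) (n - 1)); apply/and3P; split.
- by rewrite size_mkseq.
- rewrite /is_snake; apply/(sortedP (0, 0)%R) => i; rewrite size_mkseq => hi.
  rewrite !nth_mkseq //; last by lia.
  by rewrite gluedE /=; case: ifP; rewrite eqxx ?orbT.
- apply/allP => -[|[|i]]; rewrite mem_index_iota // => hi.
  rewrite /nth_tile /= !nth_mkseq; try lia.
  rewrite /straight /=.
  case: (i.+2 \in C); case: (turn C i) => /=; lia.
Qed.

Lemma count_UD_pow b k : count_mem b (UD_pow k) = k.
Proof. by case: b; elim: k => /= [|k ->]. Qed.

Lemma is_dyckP n w :
  reflect [/\ count_mem U w = n, count_mem D w = n &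
      forall l, count_mem D (take l w) <= count_mem U (take l w)]
    (is_dyck n w).
Proof.
apply: (iffP and3P) => -[h1 h2 h3].
- split; [exact/eqP|exact/eqP|move=> l].
  case: (leqP l (size w)) => hl.
    by apply: (allP h3); rewrite mem_iota add0n ltnS.
  by rewrite take_oversize ?(eqP h1) ?(eqP h2) // ltnW.
- by rewrite h1 h2 eqxx; split=> //; apply/allP => l _.
Qed.

Lemma is_dyck_cat m n v w :
  is_dyck m v -> is_dyck n w -> is_dyck (m + n) (v ++ w).
Proof.
move=> /is_dyckP[a1 a2 a3] /is_dyckP[b1 b2 b3]; apply/is_dyckP.
rewrite !count_cat a1 a2 b1 b2; split=> // l.
rewrite take_cat; case: ifP => _ //.
by rewrite !count_cat a1 a2 leq_add2l.
Qed.

Lemma is_dyck_E n : is_dyck n (E_ n).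
Proof.
apply/is_dyckP; rewrite !count_cat !count_nseq /= !mul0n !mul1n addn0.
split=> // l; rewrite take_cat size_nseq; case: ifP => hl.
  by rewrite take_nseq ?count_nseq //= ltnW.
have [h|h] := leqP (l - n) n.
  by rewrite !count_cat take_nseq // !count_nseq /=; lia.
by rewrite take_oversize ?size_nseq ?(ltnW h) // !count_cat !count_nseq /=; lia.
Qed.

Lemma is_dyck_UD k : is_dyck k (UD_pow k).
Proof.
elim: k => // k; rewrite -[k.+1]add1n; exact: (@is_dyck_cat 1 k [:: U; D]).
Qed.

Lemma is_dyck_U1 n i : 1 <= i <= n - 2 -> is_dyck n (U1 n i).
Proof.
move=> hi; have {1}-> : n = i.+1 + (n - i - 1) by lia.
exact: is_dyck_cat (is_dyck_E _) (is_dyck_UD _).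
Qed.

Lemma is_dyck_U2 n i : 1 <= i <= n - 2 -> is_dyck n (U2 n i).
Proof.
move=> hi; have {1}-> : n = i + (n - i) by lia.
exact: is_dyck_cat (is_dyck_UD _) (is_dyck_E _).
Qed.

(* Main.v *)
Require Import Defs.
From mathcomp Require Import all_boot all_order all_algebra.
From mathcomp Require Import finmap zify.

Set Implicit Arguments.
Unset Strict Implicit.
Unset Printing Implicit Defensive.
Import Order.TTheory GRing.Theory Num.Theory.
Local Open Scope fset_scope.
Local Open Scope nat_scope.

(** Both sets are encoded by the same bit sequences [c 0, ..., c (n - 2)], one
    bit for each tile.

    Matchings.  Grow the snake graph tile by tile, starting from the single
    edge through which the first tile is entered.  Each new tile is glued to
    the graph built so far along one shared edge, and brings three new edges:
    the far edge, opposite to the shared one, and two sides.  A perfect matching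
    of the larger graph covers the two new vertices either by the far edge
    (bit [false]), and what remains is an arbitrary perfect matching of the
    smaller graph, or by the two sides (bit [true]), and what remains becomes,
    once the shared edge is added, a perfect matching of the smaller graph
    that contains this edge ([attach_perfect_matching],
    [perfect_matching_attach], [attach_inj]).  Whether the shared edge is in
    the smaller matching can be read off the preceding bit: if the snake goes
    straight, the shared edge is the far edge of the preceding tile, and
    otherwise it is one of its sides ([near_edge_code_matching]).  Hence perfect
    matchings correspond to the bit sequences such that [c i.+1] implies that
    [c i] is [true] if the snake turns at the tile of index [i], that is, if
    [i.+1] is not in [C], and [false] if it goes straight there.  The first tile
    counts as straight, in accordance with 1 being in [C].

    Words.  Let the bit [c i] say whether [V_i] is [U_2^i].  The rules defining
    the set of words allow [U_2^i] after [U_2^{i-1}] exactly when [i] is not in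
    [C], and after the two other letters exactly when [i] is in [C]; when [V_i]
    is not [U_2^i], it is determined by the preceding bit and by whether [i] is
    in [C].  The first letter is unconstrained: as 1 is in [C], its three
    values are the three bit pairs [c 0, c 1] that satisfy the same rule, with
    [c 0] distinguishing [U_1^1] from [E_n]. *)

(** * Bijections between subtypes, and unions of finite sets *)

Lemma sig_bijective (A B : choiceType) (P : pred A) (Q : pred B) (f : A -> B) :
  (forall a, P a -> Q (f a)) ->
  (forall a1 a2, P a1 -> P a2 -> f a1 = f a2 -> a1 = a2) ->
  (forall b, Q b -> exists2 a, P a & f a = b) ->
  exists F : {a | P a} -> {b | Q b}, bijective F.
Proof.
move=> fP fI fS.
have gP (b : {b | Q b}) : exists a, P a && (f a == sval b).
  by have [a Pa <-] := fS _ (valP b); exists a; rewrite Pa eqxx.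
have gK b := andP (xchooseP (gP b)).
pose F (a : {a | P a}) : {b | Q b} := Sub (f (val a)) (fP _ (valP a)).
pose G (b : {b | Q b}) : {a | P a} := Sub (xchoose (gP b)) (gK b).1.
exists F, G => [a|b]; apply: val_inj; rewrite !SubK; last first.
  by have [_ /eqP] := gK b.
by have [Pa /eqP ea] := gK (F a); apply: fI => //; exact: valP.
Qed.

Lemma fsetU_absorb (K : choiceType) (A B S N : {fset K}) :
  B `<=` A `|` S -> A `|` (S `|` (B `|` N)) = (A `|` S) `|` N.
Proof. by move=> /fsetUidPl h; rewrite !fsetUA h. Qed.

Lemma fset4_perm (K : choiceType) (a b c e : K) :
  ([fset a; b; c; e] = [fset c] `|` [fset e; a; b]) *
  ([fset a; b; c; e] = [fset a] `|` [fset b; c; e]).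
Proof.
by split; apply/fsetP => z; rewrite !inE;
  case: (z == a); case: (z == b); case: (z == c); case: (z == e).
Qed.

Lemma fset4_pair (K : choiceType) (a b c e : K) :
  [fset a; b; c; e] = [fset a; c] `|` [fset b; e].
Proof. by rewrite fsetUA (fsetUAC [fset a]). Qed.

(** * Perfect matchings and degrees *)

Section Degree.
Context (K : choiceType).
Implicit Types (V : {fset K}) (E M : {fset {fset K}}) (e : {fset K}) (v : K).

(** The number of edges of [M] that are incident to [v]. *)
Definition degree M v := #|` [fset e in M | v \in e]|.

Lemma perfect_matchingP V E M :
  reflect (M `<=` E /\ forall v, v \in V -> degree M v = 1)
    (is_perfect_matching V E M).
Proof.
apply: (iffP andP) => -[ME h]; split=> //; first by move=> v /(allP h) /eqP.
by apply/allP => v /h /eqP.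
Qed.

Lemma degreeU1 e M v :
  e \notin M -> degree (e |` M) v = (v \in e) + degree M v.
Proof.
move=> eM; rewrite /degree; have [ve|ve] := boolP (v \in e).
  rewrite (_ : [fset f in _ | _] = e |` [fset f in M | v \in f]).
    by rewrite cardfsU1 !inE (negbTE eM).
  by apply/fsetP => f; rewrite !inE; case: eqP => // ->; rewrite ve.
rewrite add0n; congr #|` _|; apply/fsetP => f; rewrite !inE.
by case: eqP => // ->; rewrite (negbTE ve) !andbF.
Qed.

Lemma degreeD1 e M v :
  e \in M -> degree M v = (v \in e) + degree (M `\ e) v.
Proof. by move=> eM; rewrite -{1}(fsetD1K eM) degreeU1 // !inE eqxx. Qed.

Lemma degree_eq0 M V v :
  {in M, forall f, f `<=` V} -> v \notin V -> degree M v = 0.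
Proof.
move=> MV vV; apply/eqP; rewrite cardfs_eq0; apply/eqP/fsetP => f.
rewrite !inE; apply/negP => /andP[/MV /fsubsetP fV /fV].
exact/negP.
Qed.

End Degree.

(** * Attaching a square along an edge *)

(** The square has vertices [u, w, y, x] in cyclic order.  Its edge [uw] is
    in the graph [(V, E)], and its vertices [x] and [y] are new. *)
Section Attach.
Context (K : choiceType) (V : {fset K}) (E : {fset {fset K}}) (u w x y : K).
Implicit Types (M : {fset {fset K}}) (b : bool).

Let shared := [fset u; w].
Let far_edge := [fset x; y].
Let side_u := [fset u; x].
Let side_w := [fset w; y].

(** Extends a matching of [(V, E)] to the square, through the far edge if [b]
    is [false]; if [b] is [true], through the two sides, at the expense of the
    shared edge. *)
Definition attach (b : bool) M : {fset {fset K}} :=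
  if b then side_u |` (side_w |` (M `\ shared)) else far_edge |` M.

Hypotheses (EV : {in E, forall f, f `<=` V}) (sharedE : shared \in E).
Hypotheses (uw : u != w) (xy : x != y) (xV : x \notin V) (yV : y \notin V).

Let V' := V `|` [fset x; y].
Let E' := E `|` [fset far_edge; side_u; side_w].

Let uV : u \in V.
Proof. by apply: (fsubsetP (EV sharedE)); rewrite !inE eqxx. Qed.

Let wV : w \in V.
Proof. by apply: (fsubsetP (EV sharedE)); rewrite !inE eqxx orbT. Qed.

Let neV v z : v \in V -> z \notin V -> (v == z = false) * (z == v = false).
Proof.
by move=> vV zV; split; apply/negP => /eqP ?; subst; rewrite vV in zV.
Qed.

Let simpV := (neV uV xV, neV uV yV, neV wV xV, neV wV yV,
  negbTE uw, negbTE xy, eq_sym w u, eq_sym y x).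

Let new_notin_E f z : z \notin V -> z \in f -> f \notin E.
Proof. by move=> zV zf; apply/negP => /EV /fsubsetP /(_ _ zf); apply/negP. Qed.

Let far_edgeE : far_edge \notin E.
Proof. by apply: (new_notin_E xV); rewrite !inE eqxx. Qed.
Let side_uE : side_u \notin E.
Proof. by apply: (new_notin_E xV); rewrite !inE eqxx orbT. Qed.
Let side_wE : side_w \notin E.
Proof. by apply: (new_notin_E yV); rewrite !inE eqxx orbT. Qed.

Let far_side_u : far_edge != side_u.
Proof. by apply/eqP => /fsetP /(_ y); rewrite !inE !simpV eqxx. Qed.
Let far_side_w : far_edge != side_w.
Proof. by apply/eqP => /fsetP /(_ x); rewrite !inE !simpV eqxx. Qed.
Let side_uw : side_u != side_w.
Proof. by apply/eqP => /fsetP /(_ u); rewrite !inE !simpV eqxx. Qed.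

Let notin_sub f M : M `<=` E -> f \notin E -> f \notin M.
Proof. by move=> /fsubsetP ME; apply: contra; exact: ME. Qed.

(* On [V], the two sides together cover the same vertices as the shared edge,
   so that trading this edge for the sides does not change the degrees. *)
Let degree_swap M v : M `<=` E -> shared \in M ->
  degree (attach true M) v + (v \in shared) =
  (v \in side_u) + (v \in side_w) + degree M v.
Proof.
move=> ME eM; rewrite (degreeD1 v eM) /attach degreeU1; last first.
  by rewrite !inE (negbTE side_uw) (negbTE (notin_sub ME side_uE)) andbF.
rewrite degreeU1; last by rewrite !inE (negbTE (notin_sub ME side_wE)) andbF.
by rewrite addnA -addnA (addnC (degree _ _)).
Qed.

Lemma attach_sub b M : M `<=` E -> attach b M `<=` E'.
Proof.
move=> ME; apply/fsubsetP => f; case: b; rewrite !inE.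
  by case/or3P=> [->|->|/andP[_ /(fsubsetP ME) ->]] //; rewrite ?orbT.
by case/orP=> [->|/(fsubsetP ME) ->] //; rewrite ?orbT.
Qed.

Lemma attach_perfect_matching b M :
  is_perfect_matching V E M -> (b -> shared \in M) ->
  is_perfect_matching V' E' (attach b M).
Proof.
move=> /perfect_matchingP[ME M1] bM; apply/perfect_matchingP.
have MV : {in M, forall f, f `<=` V} by move=> f /(fsubsetP ME) /EV.
have [Mx My] := (degree_eq0 MV xV, degree_eq0 MV yV).
split; first exact: attach_sub.
move=> v vV'; case: b bM => bM.
  have := degree_swap v ME (bM isT).
  move: vV'; rewrite !inE => /or3P[vV|/eqP->|/eqP->].
  - rewrite M1 // !(neV vV xV) !(neV vV yV) !orbF.
    have : (v == u) && (v == w) = false.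
      by apply/negP => /andP[/eqP-> ]; apply/negP.
    by case: (v == u); case: (v == w) => //= _; rewrite ?addn0 ?addn1 // => -[].
  - by rewrite Mx !simpV eqxx /= !addn0.
  - by rewrite My !simpV eqxx /= !addn0.
rewrite degreeU1 ?(notin_sub ME) //.
move: vV'; rewrite !inE => /or3P[vV|/eqP->|/eqP->].
- by rewrite M1 // !(neV vV xV) !(neV vV yV).
- by rewrite Mx eqxx.
- by rewrite My eqxx orbT.
Qed.

Lemma perfect_matching_attach M' : is_perfect_matching V' E' M' ->
  exists (b : bool) M, [/\ is_perfect_matching V E M, b -> shared \in M
                & M' = attach b M].
Proof.
move=> /perfect_matchingP[ME' M1].
pose M := M' `&` E.
have ME : M `<=` E by apply: fsubsetIr.
have MV : {in M, forall f, f `<=` V} by move=> f /(fsubsetP ME) /EV.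
have [Mx My] := (degree_eq0 MV xV, degree_eq0 MV yV).
have inM' f : f \in M' -> [|| f \in M, f == far_edge, f == side_u | f == side_w].
  by move=> fM; have := fsubsetP ME' _ fM; rewrite !inE fM -!orbA;
    case: (f \in E).
have xV' : x \in V' by rewrite !inE eqxx orbT.
have yV' : y \in V' by rewrite !inE eqxx !orbT.
have inV v : v \in V -> v \in V' by rewrite !inE => ->.
have [eM'|eM'] := boolP (far_edge \in M').
  (* A side in M' would meet the far edge in a new vertex of degree 1. *)
  have sM' s z : s != far_edge -> z \in V' -> z \in s -> z \in far_edge ->
      s \notin M'.
    move=> se zV zs ze; apply/negP => sM'; have := M1 z zV.
    rewrite (degreeD1 z eM') ze (@degreeD1 _ s) ?zs ?inE ?se //.
  have uM' : side_u \notin M'.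
    by apply: (sM' _ x); rewrite // 1?eq_sym // !inE eqxx ?orbT.
  have wM' : side_w \notin M'.
    by apply: (sM' _ y); rewrite // 1?eq_sym // !inE eqxx ?orbT.
  have M'E : M' = attach false M.
    apply/fsetP => f; rewrite /attach in_fset1U; apply/idP/orP.
      move=> fM'; case/or4P: (inM' f fM') => [->|->|/eqP fE|/eqP fE]; auto.
        by rewrite fE (negbTE uM') in fM'.
      by rewrite fE (negbTE wM') in fM'.
    by case=> [/eqP->//|]; rewrite !inE => /andP[].
  exists false, M; split=> //; apply/perfect_matchingP; split=> // v vV.
  have := M1 v (inV v vV); rewrite M'E degreeU1 ?(notin_sub ME) //.
  by rewrite !inE !(neV vV xV) !(neV vV yV).
(* The only edges at a new vertex are the far edge and one side. *)
have sM' s z : z \in V' -> z \notin V ->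
    (forall f, f \in M' -> z \in f -> f = s) -> s \in M'.
  move=> zV' zV fs; have : 0 < degree M' z by rewrite M1.
  by rewrite cardfs_gt0 => /fset0Pn[f]; rewrite !inE => /andP[fM /(fs _ fM) <-].
have uM' : side_u \in M'.
  apply: (sM' _ x) => // f fM' xf.
  case/or4P: (inM' f fM') => [/MV/fsubsetP/(_ x xf)|/eqP fE|/eqP//|/eqP fE].
  - by rewrite (negbTE xV).
  - by rewrite fE (negbTE eM') in fM'.
  - by move: xf; rewrite fE !inE !simpV.
have wM' : side_w \in M'.
  apply: (sM' _ y) => // f fM' xf.
  case/or4P: (inM' f fM') => [/MV/fsubsetP/(_ y xf)|/eqP fE|/eqP fE|/eqP//].
  - by rewrite (negbTE yV).
  - by rewrite fE (negbTE eM') in fM'.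
  - by move: xf; rewrite fE !inE !simpV.
have M'E : M' = side_u |` (side_w |` M).
  apply/fsetP => f; rewrite !in_fset1U; apply/idP/idP.
    move=> fM'; case/or4P: (inM' f fM') => [->|/eqP fE|->|->]; rewrite ?orbT //.
    by rewrite fE (negbTE eM') in fM'.
  by case/or3P=> [/eqP->|/eqP->|] //; rewrite !inE => /andP[].
(* Otherwise u would be covered both by the shared edge and by its side. *)
have sM : shared \notin M.
  apply/negP => sM.
  have := M1 u (inV u uV); rewrite M'E degreeU1; last first.
    by rewrite !inE (negbTE side_uw) (negbTE side_uE) andbF.
  by rewrite degreeU1 ?(notin_sub ME) // (degreeD1 u sM) !inE eqxx !simpV.
have M'a : M' = attach true (shared |` M) by rewrite /attach fsetU1K.
have sME : shared |` M `<=` E by rewrite fsubUset fsub1set sharedE.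
exists true, (shared |` M); split=> //; last by rewrite !inE eqxx.
apply/perfect_matchingP; split=> // v vV.
have := degree_swap v sME (fset1U1 _ _); rewrite -M'a M1 ?inV //.
rewrite !inE !(neV vV xV) !(neV vV yV) !orbF.
have : (v == u) && (v == w) = false.
  by apply/negP => /andP[/eqP-> ]; apply/negP.
by case: (v == u); case: (v == w) => //= _; rewrite ?addn0 ?addn1 // => -[].
Qed.

Lemma far_edge_attach b M : M `<=` E -> (far_edge \in attach b M) = ~~ b.
Proof.
move=> ME; case: b; rewrite !inE ?eqxx //.
by rewrite (negbTE far_side_u) (negbTE far_side_w)
  (negbTE (notin_sub ME far_edgeE)) andbF.
Qed.

Lemma side_u_attach b M : M `<=` E -> (side_u \in attach b M) = b.
Proof.
move=> ME; case: b; rewrite !inE ?eqxx //.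
by rewrite eq_sym (negbTE far_side_u) (negbTE (notin_sub ME side_uE)).
Qed.

Lemma side_w_attach b M : M `<=` E -> (side_w \in attach b M) = b.
Proof.
move=> ME; case: b; rewrite !inE ?eqxx ?orbT //.
by rewrite eq_sym (negbTE far_side_w) (negbTE (notin_sub ME side_wE)).
Qed.

Lemma attach_inj (b1 b2 : bool) M1 M2 : M1 `<=` E -> M2 `<=` E ->
  (b1 -> shared \in M1) -> (b2 -> shared \in M2) ->
  attach b1 M1 = attach b2 M2 -> b1 = b2 /\ M1 = M2.
Proof.
move=> s1 s2 h1 h2 eM.
have eb : b1 = b2 by rewrite -(side_u_attach b1 s1) eM side_u_attach.
split=> //; subst b2; apply/fsetP => f.
have [fE|fE] := boolP (f \in E); last by rewrite !(negbTE (notin_sub _ fE)).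
have ne g : g \notin E -> f == g = false.
  by move=> gE; apply/negP => /eqP fg; rewrite fg (negbTE gE) in fE.
have := congr1 (fun A : {fset {fset K}} => f \in A) eM; rewrite /=.
case: b1 h1 h2 {eM} => h1 h2; rewrite /attach !in_fset1U.
  rewrite !(ne _ side_uE) !(ne _ side_wE) /= !in_fsetD1.
  by case: (f =P shared) => // -> _; rewrite h1 // h2.
by rewrite !(ne _ far_edgeE).
Qed.

End Attach.

(** * Tiles and edges in the plane *)

(** One unit step, to the east if [b] is [true] and to the north otherwise. *)
Definition shift (b : bool) (p : point) : point :=
  if b then east p else north p.

(** The edge of the tile [p] crossed when [p] is entered in direction [b]. *)
Definition near_edge (b : bool) (p : tile) : {fset point} :=
  [fset p; shift (~~ b) p].

(** The index of the antidiagonal of a point. *)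
Definition level (p : point) : int := (p.1 + p.2)%R.

Lemma near_edge_tile b p : near_edge b p \in tile_edges p.
Proof.
rewrite /tile_edges !in_fsetU !in_fset1 -!orbA; apply/or4P.
by case: b; [apply: Or43 | apply: Or41]; apply/eqP.
Qed.

Lemma near_edge_shift b p : near_edge b (shift b p) \in tile_edges p.
Proof.
rewrite /tile_edges !in_fsetU !in_fset1 -!orbA; apply/or4P.
by case: b; [apply: Or44 | apply: Or42]; apply/eqP.
Qed.

Lemma level_shift b p : level (shift b p) = (level p + 1)%R.
Proof. by rewrite /level; case: b p => -[a c] /=; lia. Qed.

Lemma shift_neq b p : shift b p != shift (~~ b) p.
Proof. by apply/eqP; case: b p => -[a c] [] /=; lia. Qed.

Lemma shift_neq_id b p : p != shift b p.
Proof.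
by apply/eqP => /(congr1 level); rewrite level_shift; move: (level p); lia.
Qed.

Lemma ne_level p : level (north (east p)) = (level p + 2)%R.
Proof. by rewrite /level; case: p => a c /=; lia. Qed.

Lemma straight_shift b1 b2 p :
  straight p (shift b1 p) (shift b2 (shift b1 p)) = (b2 == b1).
Proof. by case: p b1 b2 => a b [] []; rewrite /straight /=; lia. Qed.

(** * Perfect matchings of a snake graph *)

(** [d k] is the direction in which tile number [k] is entered, counting from
    0.  For the first tile, [d 0] is a convention. *)
Section Snake.
Context (p0 : point) (d : nat -> bool).

(** Tile number [k]. *)
Fixpoint walk (k : nat) : tile :=
  if k is j.+1 then shift (d k) (walk j) else p0.

(** The graph formed by the edge through which the first tile is entered and
    by the first [k] tiles.  Starting from a single edge, rather than from one
    tile, lets every tile be attached along an edge. *)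
Definition grown_vertices (k : nat) : {fset point} :=
  near_edge (d 0) p0 `|` snake_vertices (mkseq walk k).
Definition grown_edges (k : nat) : {fset {fset point}} :=
  near_edge (d 0) p0 |` snake_edges (mkseq walk k).

(* The corners of tile number [k]: [u, w] is the edge it is entered through, and
   [x], [y] are the ends of the far edge. *)
Let u k := walk k.
Let w k := shift (~~ d k) (walk k).
Let x k := shift (d k) (walk k).
Let y k := north (east (walk k)).

Lemma snake_verticesS k :
  snake_vertices (mkseq walk k.+1) =
  snake_vertices (mkseq walk k) `|` tile_vertices (walk k).
Proof. by rewrite /snake_vertices mkseqS big_rcons. Qed.

Lemma snake_edgesS k :
  snake_edges (mkseq walk k.+1) =
  snake_edges (mkseq walk k) `|` tile_edges (walk k).
Proof. by rewrite /snake_edges mkseqS big_rcons. Qed.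

Lemma near_edge_grown k : near_edge (d k) (walk k) \in grown_edges k.
Proof.
case: k => [|k]; first exact: fset1U1.
rewrite /grown_edges snake_edgesS; apply/fset1UP; right; apply/fsetUP; right.
exact: near_edge_shift.
Qed.

Lemma grown_edgesS k :
  grown_edges k.+1 = grown_edges k `|`
    [fset [fset x k; y k]; [fset u k; x k]; [fset w k; y k]].
Proof.
have tE : tile_edges (walk k) = [fset near_edge (d k) (walk k)] `|`
    [fset [fset x k; y k]; [fset u k; x k]; [fset w k; y k]].
  rewrite /u /w /x /y /near_edge; case: (d k).
    exact: (fset4_perm _ _ (west_edge _) (east_edge _)).1.
  exact: (fset4_perm (south_edge _) (north_edge _) _ _).2.
rewrite /grown_edges snake_edgesS tE; apply: fsetU_absorb.
by rewrite fsub1set; exact: near_edge_grown.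
Qed.

Lemma grown_verticesS k :
  near_edge (d k) (walk k) `<=` grown_vertices k ->
  grown_vertices k.+1 = grown_vertices k `|` [fset x k; y k].
Proof.
have tE : tile_vertices (walk k) =
    near_edge (d k) (walk k) `|` [fset x k; y k].
  rewrite /x /y /near_edge; case: (d k); last exact/esym/fsetUA.
  exact: (fset4_pair _ _ (north _)).
rewrite /grown_vertices snake_verticesS tE; exact: fsetU_absorb.
Qed.

Lemma grown_edges_sub k : {in grown_edges k, forall f, f `<=` grown_vertices k}.
Proof.
elim: k => [|k IHk] f.
  rewrite /grown_edges /snake_edges big_nil fsetU0 => /fset1P->.
  exact: fsubsetUl.
have nk := IHk _ (near_edge_grown k).
rewrite grown_edgesS grown_verticesS // in_fsetU => /orP[/IHk h|].
  exact: fsubset_trans h (fsubsetUl _ _).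
have uV : u k \in grown_vertices k.
  by apply: (fsubsetP nk); rewrite !inE eqxx.
have wV : w k \in grown_vertices k.
  by apply: (fsubsetP nk); rewrite !inE eqxx orbT.
rewrite !in_fsetU !in_fset1 => /orP[/orP[]|] /eqP-> ; apply/fsubsetP => v;
  rewrite in_fset2 => /orP[] /eqP->;
  by rewrite in_fsetU ?uV ?wV // in_fset2 eqxx ?orbT.
Qed.

Lemma near_edge_sub k :
  near_edge (d k) (walk k) `<=` grown_vertices k.
Proof. exact/grown_edges_sub/near_edge_grown. Qed.

(** Ensures that the far corners of tile number [k] are new vertices: they have
    a higher level than its corner [walk k], and are not in its near edge. *)
Lemma grown_vertices_level k v : v \in grown_vertices k ->
  v \in near_edge (d k) (walk k) \/ (level v <= level (walk k))%R.
Proof.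
elim: k v => [|k IHk] v.
  by rewrite /grown_vertices /snake_vertices big_nil fsetU0; left.
have lw : level (walk k.+1) = (level (walk k) + 1)%R by exact: level_shift.
have le b : v = walk k \/ v = shift b (walk k) ->
    (level v <= level (walk k.+1))%R.
  by rewrite lw => -[->|->]; rewrite ?level_shift ?lexx // lerDl.
rewrite grown_verticesS; last exact: near_edge_sub.
rewrite in_fsetU => /orP[/IHk[]|].
- rewrite in_fset2 => /orP[] /eqP vE; right; apply: (le (~~ d k)).
    by left.
  by right.
- by move=> h; right; rewrite lw (le_trans h) // lerDl.
- rewrite in_fset2 => /orP[] /eqP vE.
    by right; apply: le; right; exact: vE.
  left; rewrite in_fset2; apply/orP; right; apply/eqP; rewrite vE /=.
  by case: (d k.+1).
Qed.

Let uw k : u k != w k.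
Proof. exact: shift_neq_id. Qed.

Let xy k : x k != y k.
Proof.
apply/eqP => /(congr1 level); rewrite level_shift ne_level.
by move: (level _); lia.
Qed.

Let xV k : x k \notin grown_vertices k.
Proof.
apply/negP => /grown_vertices_level[|].
  rewrite in_fset2 eq_sym (negbTE (shift_neq_id _ _)).
  by rewrite (negbTE (shift_neq _ _)).
by rewrite level_shift; move: (level _); lia.
Qed.

Let yV k : y k \notin grown_vertices k.
Proof.
apply/negP => /grown_vertices_level[|].
  by rewrite in_fset2 => /orP[] /eqP/(congr1 level);
    rewrite ne_level ?level_shift; move: (level _); lia.
by rewrite ne_level; move: (level _); lia.
Qed.

(** The matching of the graph of the first [k] tiles that is described by the
    bits [c 0, ..., c k.-1], if they satisfy [valid_code] below. *)
Fixpoint code_matching (c : nat -> bool) (k : nat) : {fset {fset point}} :=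
  if k is j.+1 then attach (u j) (w j) (x j) (y j) (c j) (code_matching c j)
  else [fset near_edge (d 0) p0].

(** The two sides of a tile may be used only if the edge shared with the
    preceding tile is in the matching built so far; see
    [near_edge_code_matching]. *)
Definition valid_code (c : nat -> bool) (k : nat) : Prop :=
  forall i, i.+1 < k -> c i.+1 -> c i = (d i.+1 != d i).

Lemma code_matching_ext c c' k :
  (forall i, i < k -> c i = c' i) -> code_matching c k = code_matching c' k.
Proof.
elim: k => //= k IHk cc'; rewrite cc' // IHk // => i ik.
by apply: cc'; exact: ltnW.
Qed.

Lemma code_matching_sub c k : code_matching c k `<=` grown_edges k.
Proof.
elim: k => [|k IHk]; first exact: fsubsetUl.
by rewrite grown_edgesS; exact: attach_sub.
Qed.

(** The exit edge of a tile is its far edge if the snake goes straight, and one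
    of its sides if the snake turns. *)
Lemma near_edge_code_matching c k :
  (near_edge (d k.+1) (walk k.+1) \in code_matching c k.+1)
  = (c k == (d k.+1 != d k)).
Proof.
have -> : near_edge (d k.+1) (walk k.+1) =
    if d k.+1 == d k then [fset x k; y k] else [fset w k; y k].
  by rewrite /near_edge /w /x /y /=; case: (d k.+1); case: (d k).
have EV := @grown_edges_sub k; have nE := near_edge_grown k.
have s := code_matching_sub c k.
case: (d k.+1 == d k) => /=.
  by rewrite (far_edge_attach EV nE (xy k) (xV k) (yV k)) // eqbF_neg.
by rewrite (side_w_attach EV nE (xy k) (xV k) (yV k)) // eqb_id.
Qed.

Lemma valid_code_near_edge c k : valid_code c k.+1 ->
  c k -> near_edge (d k) (walk k) \in code_matching c k.
Proof.
case: k => [|k] cv ck; first exact: fset11.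
by rewrite near_edge_code_matching (cv k).
Qed.

Lemma code_matching_perfect c k : valid_code c k ->
  is_perfect_matching (grown_vertices k) (grown_edges k) (code_matching c k).
Proof.
elim: k => [|k IHk] cv.
  rewrite /grown_vertices /grown_edges /snake_vertices /snake_edges !big_nil.
  rewrite !fsetU0; apply/perfect_matchingP; split=> // v vV.
  by rewrite -[code_matching _ _]fsetU0 degreeU1 // vV (@degree_eq0 _ _ fset0).
rewrite grown_verticesS ?near_edge_sub // grown_edgesS /=.
apply: attach_perfect_matching.
- exact: grown_edges_sub.
- exact: near_edge_grown.
- exact: uw.
- exact: xy.
- exact: xV.
- exact: yV.
- by apply: IHk => i ik; apply: cv; exact: ltnW.
- exact: valid_code_near_edge.
Qed.

Lemma perfect_matching_code k M :
  is_perfect_matching (grown_vertices k) (grown_edges k) M ->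
  exists2 c, valid_code c k & M = code_matching c k.
Proof.
elim: k M => [|k IHk] M.
  rewrite /grown_vertices /grown_edges /snake_vertices /snake_edges !big_nil.
  rewrite !fsetU0 => /perfect_matchingP[ME /(_ p0) M1].
  exists xpred0 => //; apply/eqP; rewrite eqEfsubset ME fsub1set /=.
  have : 0 < degree M p0 by rewrite M1 // in_fset2 eqxx.
  rewrite cardfs_gt0 => /fset0Pn[f]; rewrite !inE => /andP[fM _].
  by have /fset1P<- := fsubsetP ME _ fM.
rewrite grown_verticesS ?near_edge_sub // grown_edgesS.
move=> /(perfect_matching_attach (@grown_edges_sub k) (near_edge_grown k)
  (uw k) (xy k) (xV k) (yV k))[b [N [/[dup] Npm /IHk[c cv NE] bN ->]]].
pose c' i := if i == k then b else c i.
have cc' i : i < k -> c i = c' i by rewrite /c' => /ltn_eqF ->.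
exists c' => [i|]; last by rewrite /= -(code_matching_ext cc') -NE /c' eqxx.
rewrite ltnS leq_eqVlt => /orP[/eqP ik|ik]; last first.
  by rewrite -!cc' //; [exact: cv | exact: ltnW].
rewrite -(cc' i) -?ik // /c' ik eqxx => /bN; rewrite NE -ik.
rewrite -[X in X \in _]/(near_edge (d i.+1) (walk i.+1)).
by rewrite near_edge_code_matching => /eqP.
Qed.

Lemma code_matching_inj c c' k : valid_code c k -> valid_code c' k ->
  code_matching c k = code_matching c' k -> forall i, i < k -> c i = c' i.
Proof.
elim: k => // k IHk cv cv'.
have ltS j : valid_code j k.+1 -> valid_code j k.
  by move=> jv i ik; apply: jv; exact: ltnW.
move=> /(attach_inj (@grown_edges_sub k) (near_edge_grown k)
  (xy k) (xV k) (yV k) (code_matching_sub c k) (code_matching_sub c' k)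
  (valid_code_near_edge cv) (valid_code_near_edge cv'))[ck eM] i.
by rewrite ltnS leq_eqVlt => /orP[/eqP->//|]; apply: IHk; auto.
Qed.

End Snake.

(** * Directions of a snake *)

(** The direction, [true] for east, in which tile number [i] is entered.  As
    [0.-1.+1] is 1, the first tile gets the direction of the second one, as
    if the snake went straight at its first tile; this agrees with [1 \in C]. *)
Definition snake_direction (T : seq tile) (i : nat) : bool :=
  nth (0, 0)%R T i.-1.+1 == east (nth (0, 0)%R T i.-1).

Lemma snake_walk T : is_snake T ->
  T = mkseq (walk (head (0, 0)%R T) (snake_direction T)) (size T).
Proof.
move=> /(sortedP (0, 0)%R) sT; apply: (@eq_from_nth _ (0, 0)%R).
  by rewrite size_mkseq.
move=> i hi; rewrite nth_mkseq //; elim: i hi => [|i IHi] hi.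
  by rewrite nth0.
rewrite /= -IHi 1?ltnW // /snake_direction /=.
have := sT i hi; rewrite gluedE /shift => /orP[] /eqP ->; last by rewrite eqxx.
case: ifP => // /eqP; case: (nth _ _ _) => a b; rewrite /north /east /=.
by case; lia.
Qed.

Lemma snake_direction_turn n C T i : 3 <= n -> 1 \in C -> is_snake_of n C T ->
  i.+1 < n - 1 ->
  (snake_direction T i.+1 != snake_direction T i) = (i.+1 \notin C).
Proof.
move=> hn C1 /and3P[/eqP sT /snake_walk TE /allP st].
case: i => [|i] hi; first by rewrite /snake_direction /= eqxx C1.
have := st i.+2; rewrite mem_index_iota hi => /(_ isT) /eqP <-.
have tE j : j < n - 1 -> nth (0, 0)%R T j =
    walk (head (0, 0)%R T) (snake_direction T) j.
  by move=> hj; rewrite {1}TE nth_mkseq // sT.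
by rewrite /nth_tile /= !tE /= ?straight_shift //; lia.
Qed.

(** * Words and their codes *)

Lemma E_U1_neq n i : i < n - 1 -> E_ n != U1 n i.
Proof.
move=> ltin; apply/eqP => /(congr1 (fun s => nth D s i.+1)).
rewrite /U1 /E_ -catA !nth_cat !size_nseq ltnn subnn.
have -> : i.+1 < n by lia.
by rewrite nth_nseq ifT //; lia.
Qed.

Lemma E_U2_neq n i : 0 < i < n -> E_ n != U2 n i.
Proof. by case: i n => [|i] [|[|n]]. Qed.

Lemma U1_U2_neq n i : 0 < i -> U1 n i != U2 n i.
Proof. by case: i. Qed.

Section Words.
Context (n : nat) (C : {fset nat}).

(** The letter [V_i] encoded by the bits [c i.-1] and [c i]. *)
Definition code_letter (c : nat -> bool) (i : nat) : seq step :=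
  if c i then U2 n i else if c i.-1 == (i \in C) then U1 n i else E_ n.

Definition code_word (c : nat -> bool) : seq (seq step) :=
  mkseq (fun i => code_letter c i.+1) (n - 2).

(** The bit of index 0 tells [U_1^1] from [E_n] as first letter; the bit of
    index [i > 0] tells whether [V_i] is [U_2^i]. *)
Definition word_code (V : seq (seq step)) (i : nat) : bool :=
  if i is 0 then letter V 1 == U1 n 1 else letter V i == U2 n i.

(** The validity condition on the code of a matching, in terms of [C]. *)
Definition compatible_code (c : nat -> bool) : Prop :=
  forall i, i.+1 < n - 1 -> c i.+1 -> c i = (i.+1 \notin C).

Lemma letter_code_word c i : 0 < i < n - 1 ->
  letter (code_word c) i = code_letter c i.
Proof.
by case: i => // i hi; rewrite /letter nth_mkseq //; lia.
Qed.

Let distinct i : 0 < i < n - 1 ->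
  ((E_ n == U1 n i) = false) * ((E_ n == U2 n i) = false)
  * ((U1 n i == E_ n) = false) * ((U2 n i == E_ n) = false)
  * ((U1 n i == U2 n i) = false) * ((U2 n i == U1 n i) = false).
Proof.
move=> /andP[i0 hi]; rewrite ![_ == E_ n]eq_sym [U2 n i == _]eq_sym.
by rewrite !(negbTE (U1_U2_neq _ i0)) !(negbTE (E_U1_neq hi))
  !(negbTE (@E_U2_neq n i _)) //; lia.
Qed.

Lemma code_letter_U2 c i : 0 < i < n - 1 ->
  (code_letter c i == U2 n i) = c i.
Proof.
move=> hi; rewrite /code_letter; case: (c i); rewrite ?eqxx //.
by case: ifP => _; rewrite distinct.
Qed.

Lemma code_letter_EU1 c i : 0 < i < n - 1 ->
  (code_letter c i \in [:: E_ n; U1 n i]) = ~~ c i.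
Proof.
move=> hi; rewrite /code_letter !inE; case: (c i); first by rewrite !distinct.
by case: ifP => _; rewrite !eqxx ?orbT.
Qed.

Lemma code_word_in_X c : 3 <= n -> compatible_code c -> in_X n C (code_word c).
Proof.
move=> hn cc; apply/and3P; split; first by rewrite size_mkseq.
  apply/allP => i; rewrite mem_index_iota => hi.
  rewrite letter_code_word // /code_letter !inE.
  by case: (c i); last case: ifP => _; rewrite !eqxx ?orbT.
apply/allP => -[|[|i]]; rewrite mem_index_iota // => hi.
have hi1 : 0 < i.+1 < n - 1 by lia.
have hi2 : 0 < i.+2 < n - 1 by lia.
rewrite !letter_code_word // code_letter_U2 // code_letter_EU1 //.
have := cc i.+1; rewrite /code_letter /=.
case: (c i.+2) => [/(_ _ isT) ->|_]; rewrite /= ?negbK.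
- by case: (_ \in C); rewrite !inE eqxx ?orbT.
- by case/andP: hi2.
- by case: (_ \in C); case: (c i.+1); rewrite /= ?inE ?eqxx ?orbT.
Qed.

Lemma code_word_ext c c' : 3 <= n -> (forall i, i < n - 1 -> c i = c' i) ->
  code_word c = code_word c'.
Proof.
move=> hn cc'; apply/eq_in_map => i; rewrite mem_iota => hi.
by rewrite /code_letter !cc' //=; lia.
Qed.

Lemma code_wordK c i : 3 <= n -> 1 \in C -> compatible_code c ->
  i < n - 1 -> word_code (code_word c) i = c i.
Proof.
move=> hn C1 cc hi; have h1 : 0 < 1 < n - 1 by lia.
case: i hi => [|i] hi; rewrite /word_code letter_code_word //; last first.
  by rewrite code_letter_U2.
rewrite /code_letter C1; have := cc 0 h1; rewrite C1.
case: (c 1) => [-> //|_].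
by case: (c 0); rewrite ?eqxx ?distinct.
Qed.

Lemma word_code_compatible V : 3 <= n -> 1 \in C -> in_X n C V ->
  compatible_code (word_code V).
Proof.
move=> hn C1 /and3P[_ /allP hl /allP hs] [|i] hi.
  by rewrite C1 /word_code => /eqP->; rewrite distinct.
have := hs i.+2; rewrite mem_index_iota hi => /(_ isT) /=.
have := hl i.+1; rewrite mem_index_iota (ltnW hi) => /(_ isT).
rewrite /word_code !inE orbA => h + /eqP L2; rewrite L2.
case: (letter V i.+1 == U2 n i.+1) h => [_|]; last rewrite orbF => ->.
  by case: (_ \in C); rewrite //= distinct // andbF.
by case: (_ \in C) => //=; rewrite distinct.
Qed.

Lemma word_codeK V : 3 <= n -> 1 \in C -> in_X n C V ->
  code_word (word_code V) = V.
Proof.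
move=> hn C1 /and3P[/eqP sV /allP hl /allP hs].
apply: (@eq_from_nth _ [::]); rewrite size_mkseq ?sV // => i hi.
rewrite nth_mkseq //.
have hi1 : 0 < i.+1 < n - 1 by lia.
have := hl i.+1; rewrite mem_index_iota hi1 => /(_ isT).
have -> : nth [::] V i = letter V i.+1 by [].
rewrite /code_letter; case: i hi hi1 => [|i] hi hi1.
  rewrite C1 !inE eqb_id /word_code.
  by move=> /or3P[] /eqP->; rewrite ?eqxx ?distinct.
have := hs i.+2; rewrite mem_index_iota hi1 => /(_ isT).
have hi2 : 0 < i.+1 < n - 1 by apply: ltnW.
have := hl i.+1; rewrite mem_index_iota hi2 => /(_ isT).
rewrite -pred_Sn !inE orbA /word_code.
case: (letter V i.+2 =P U2 n i.+2) => [->//|_].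
case: (letter V i.+1 == U2 n i.+1) => [_|]; last rewrite orbF => ->.
  case: (_ \in C) => /= [/andP[_ /eqP->]|/andP[_]] //.
  by rewrite orbF => /eqP->.
by case: (_ \in C) => /= /andP[]; rewrite ?orbF => /eqP->.
Qed.

End Words.

(** * The correspondence *)

Theorem lemma23 (n : nat) (C : {fset nat}) (T : seq tile)
    (hn : 3 <= n) (hC : admissible n C) (hT : is_snake_of n C T) :
  exists f : X n C -> perfect_matchings (snake_vertices T) (snake_edges T),
    bijective f.
Proof.
have C1 : 1 \in C by case/and3P: hC.
have [/eqP sT /snake_walk TE _] := and3P hT.
have [p [d [{}TE turn]]] : exists p d, T = mkseq (walk p d) (n - 1) /\
    forall i, i.+1 < n - 1 -> (d i.+1 != d i) = (i.+1 \notin C).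
  exists (head (0, 0)%R T), (snake_direction T); split; first by rewrite -sT.
  by move=> i; exact: snake_direction_turn hn C1 hT.
have valid c : valid_code d c (n - 1) <-> compatible_code n C c.
  by split=> cv i hi ci; rewrite (cv i hi ci) turn.
have [k nE] : exists k, n - 1 = k.+1 by exists (n - 2); lia.
have EE : grown_edges p d (n - 1) = snake_edges T.
  rewrite TE /grown_edges nE; apply/fsetUidPr; rewrite fsub1set.
  by apply/bigfcupP; exists p; rewrite ?near_edge_tile // andbT /= inE eqxx.
have VE : grown_vertices p d (n - 1) = snake_vertices T.
  rewrite TE /grown_vertices nE; apply/fsetUidPr/fsubsetP => v.
  rewrite in_fset2 => vE; apply/bigfcupP; exists p.
    by rewrite andbT /= inE eqxx.
  by case/orP: vE => /eqP->; case: (d 0); rewrite !inE eqxx ?orbT.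
have ok V : in_X n C V -> valid_code d (word_code n V) (n - 1).
  by move=> VX; exact/valid/word_code_compatible.
apply: (@sig_bijective _ _ (in_X n C)
  (is_perfect_matching (snake_vertices T) (snake_edges T))
  (fun V => code_matching p d (word_code n V) (n - 1))).
- by move=> V /ok; rewrite -VE -EE; exact: code_matching_perfect.
- move=> V W VX WX eM; rewrite -(word_codeK hn C1 VX) -(word_codeK hn C1 WX).
  exact: code_word_ext hn (code_matching_inj (ok _ VX) (ok _ WX) eM).
- move=> M; rewrite -VE -EE => /perfect_matching_code[c /valid cc ->].
  exists (code_word n C c); first exact: code_word_in_X.
  by apply: code_matching_ext => i; exact: code_wordK.
Qed.
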